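(* Let $G=(V,w,m)$ be a locally finite weighted graph, let $R\in\mathbb{N}=\{1,2,\dots\}$, and let $K\in\mathbb{R}$. The following are equivalent: (i) For all $x,y\in V$ with $d(x,y)\le R$ we have $K_R(x,y)\ge K$. (ii) For all positive $f\in\ell^\infty(V)$ and all $t\ge 0$, pointwise on $V$, $$|\nabla_R P_t f|\le e^{-Kt}\,P_t|\nabla_R f| .$$
   Context: A weighted graph $G=(V,w,m)$ consists of a vertex set $V$, symmetric edge weights $w:V\times V\to[0,\infty)$ and a vertex measure $m:V\to(0,\infty)$; the edges are the pairs of positive weight, and $x\sim y$ means $w(x,y)>0$. Locally finite means every vertex has finitely many neighbors. Simple graphs are the case $w\in\{0,1\}$, $m\equiv1$. $d(x,y)$ is the combinatorial (path) distance. Laplacian: $\Delta f(x)=\frac1{m(x)}\sum_y w(x,y)(f(y)-f(x))$. $P_t$ ($t\ge0$) denotes the heat semigroup generated by $\Delta$; for bounded $f:V\to\mathbb{R}$ it satisfies $\partial_tP_tf=\Delta P_tf$, $P_0f=f$. $R$-gradient: $|\nabla_R f|(x)=\max_{d(x,y)\le R}|f(y)-f(x)|$. Gradient-Ollivier curvature: for $x,y\in V$, $$K_R(x,y)=\inf\big\{\Delta|\nabla_R f|(x)-(\Delta f(y)-\Delta f(x))\,\mathrm{sgn}(f(y)-f(x))\big\},$$ the infimum being over all $f:V\to\mathbb{R}$ with $|\nabla_Rf|(x)=1$ and $|f(y)-f(x)|=|\nabla_R f|(x)$ (with $\inf\emptyset=+\infty$). *)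

(* Defs.v *)
From HB Require Import structures.
From mathcomp Require Import all_boot all_order all_algebra.
From mathcomp Require Import all_classical all_reals all_analysis.

Set Implicit Arguments.
Unset Strict Implicit.
Unset Printing Implicit Defensive.

Import Order.TTheory GRing.Theory Num.Theory.
Import numFieldNormedType.Exports.

Local Open Scope classical_set_scope.
Local Open Scope ring_scope.

Record weighted_graph (R : realType) := WeightedGraph {
  vertex :> choiceType;
  weight : vertex -> vertex -> R;
  vmeasure : vertex -> R;
  weight_sym : forall x y, weight x y = weight y x;
  weight_ge0 : forall x y, 0 <= weight x y;
  vmeasure_gt0 : forall x, 0 < vmeasure x
}.

Section graph.
Context {R : realType} (G : weighted_graph R).
Implicit Types (x y : G) (f : G -> R) (W : set G) (r : nat) (t : R).

Definition adj : rel G := fun x y => 0 < weight x y.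

Definition locally_finite := forall x, finite_set [set y | adj x y].

(* [path adj x p] says that x :: p is a walk, of length [size p]; the value
   is +oo when x and y lie in different connected components. *)
Definition dist x y : \bar R :=
  ereal_inf [set (size p)%:R%:E | p in [set p | path adj x p && (last x p == y)]].

(* The sum ranges over the support of its general term, which is finite on a
   locally finite graph. *)
Definition laplacian f x : R :=
  (vmeasure x)^-1 * \sum_(y \in [set: G]) weight x y * (f y - f x).

(* On a locally finite graph balls are finite, so this supremum is a maximum. *)
Definition gradient r f x : R :=
  sup [set `|f y - f x| | y in [set y | (dist x y <= r%:R%:E)%E]].

Definition curvature r x y : \bar R :=
  ereal_inf [set (laplacian (gradient r f) x
                  - (laplacian f y - laplacian f x) * Num.sg (f y - f x))%:E
            | f in [set f | gradient r f x = 1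
                            /\ `|f y - f x| = gradient r f x]].

(* Restriction of the Laplacian to W with Dirichlet boundary condition. *)
Definition dirichlet_laplacian W f : G -> R :=
  \1_W \* laplacian (\1_W \* f).

(* exp (t * dirichlet_laplacian W) applied to the restriction of f to W. *)
Definition dirichlet_semigroup W t f x : R :=
  limn (series (fun k =>
    exp_coeff t k * iter k (dirichlet_laplacian W) (\1_W \* f) x)).

(* For f >= 0 the Dirichlet semigroups increase with the finite set W, and
   their supremum is the minimal nonnegative solution of the heat equation
   with initial value f. *)
Definition heat_semigroup_nneg t f x : R :=
  sup [set dirichlet_semigroup W t f x | W in [set W | finite_set W]].

Definition heat_semigroup t f x : R :=
  heat_semigroup_nneg t f^\+ x - heat_semigroup_nneg t f^\- x.

End graph.

(* Main.v *)
Require Import Defs.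
From mathcomp Require Import all_boot all_order all_algebra.
From mathcomp Require Import all_classical all_reals all_analysis.
From mathcomp Require Import ring lra.

Import Order.TTheory GRing.Theory Num.Theory.
Import numFieldNormedType.Exports.

Local Open Scope classical_set_scope.
Local Open Scope ring_scope.

(* (ii) => (i): only finitely many values of [f] matter, so [f] may be taken
   positive and bounded; both sides of (ii) agree at time 0 and their right
   derivatives there give the curvature bound. To avoid differentiating the
   minimal semigroup, [P_t f] is squeezed between [P^W_t f] and
   [M - P^W_t (M - f)], with the same derivative [laplacian f] at time 0.
   (i) => (ii): applied to the distance [rho] from a vertex, the curvature bound
   yields [laplacian rho <= C (1 + rho)], so [1 + rho] controls the boundary
   terms. On a large finite [W], at the first time when [|P^W_t f y - P^W_t f x|]
   reaches [exp(-Kt) P^W_t |grad f| + eps exp(Lt) (1 + rho)], the curvature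
   bound contradicts the heat equation; let [W] grow and [eps] tend to 0. *)

(** * Exponential series, one-variable derivatives and a barrier principle *)

Section real_analysis.
Context {R : realType}.
Implicit Types (a : nat -> R) (f : R -> R) (t d : R).

(** The exponential generating series of [a]. When [a k] is the [k]-th iterate of the Dirichlet
    Laplacian at a fixed vertex, this is the Dirichlet semigroup at that vertex, so matrix
    exponentials reduce to scalar power series. *)
Definition egs a t : R := limn (series (fun k => exp_coeff t k * a k)).

Definition exp_bounded a :=
  exists M C : R, [/\ 0 <= M, 0 <= C & forall k, `|a k| <= M * C ^+ k].

Lemma exp_boundedS a : exp_bounded a -> exp_bounded (fun k => a k.+1).
Proof.
move=> [M [C [M0 C0 aMC]]]; exists (M * C), C; split => //; first exact: mulr_ge0.
by move=> k; rewrite -mulrA -exprS.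
Qed.

Lemma is_cvg_egs a t : exp_bounded a ->
  cvgn (series (fun k => exp_coeff t k * a k)).
Proof.
move=> [M [C [M0 C0 aMC]]]; apply: normed_cvg.
apply: (@series_le_cvg _ _ (M *: exp_coeff (C * `|t|))) => [k /=|k /=|k /=|].
- by [].
- by rewrite mulr_ge0// divr_ge0// exprn_ge0// mulr_ge0.
- rewrite normrM /exp_coeff /= normrM normfV (ger0_norm (ler0n _ _)) normrX.
  have -> : (M *: exp_coeff (C * `|t|)) k = `|t| ^+ k / k`!%:R * (M * C ^+ k).
    by rewrite fctE /exp_coeff /= /GRing.scale/= exprMn; ring.
  by apply: ler_wpM2l; [rewrite divr_ge0 ?exprn_ge0|exact: aMC].
- exact/is_cvg_seriesZ/is_cvg_series_exp_coeff.
Qed.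

Lemma cvg_egs a t : exp_bounded a ->
  series (fun k => exp_coeff t k * a k) @ \oo --> egs a t.
Proof. exact: is_cvg_egs. Qed.

(** Termwise differentiation turns [t ^ k / k!] into [t ^ (k - 1) / (k - 1)!], that is, it shifts
    the sequence by one. *)
Lemma is_derive_egs a t : exp_bounded a ->
  is_derive t 1 (egs a) (egs (fun k => a k.+1) t).
Proof.
move=> aE.
pose c a' k : R := a' k / k`!%:R.
have cE a' s : pseries (c a') s = series (fun k => exp_coeff s k * a' k).
  by rewrite /pseries; congr series; apply/funext => k; rewrite /c /exp_coeff/=; ring.
have dc a' : pseries_diffs (c a') = c (fun k => a' k.+1).
  apply/funext => k; rewrite /pseries_diffs /c factS natrM invfM.
  by rewrite mulrCA; congr (_ * _); rewrite mulVKf.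
have -> : egs a = (fun s => limn (pseries (c a) s)).
  by apply/funext => s; rewrite cE.
have -> : egs (fun k => a k.+1) t = limn (pseries (pseries_diffs (c a)) t).
  by rewrite dc cE.
(* Geometric growth gives convergence everywhere, so any radius beyond [|t|] would do. *)
apply: (@pseries_snd_diffs _ _ (`|t| + 1)).
- by rewrite cE; exact: is_cvg_egs.
- by rewrite dc cE; exact/is_cvg_egs/exp_boundedS.
- by rewrite !dc cE; exact/is_cvg_egs/(exp_boundedS (a \o S))/exp_boundedS.
- by rewrite [ltRHS]ger0_norm ?addr_ge0// ltrDl.
Qed.

Lemma egs0 a : egs a 0 = a 0%N.
Proof.
apply/cvg_lim => //; apply: cvg_near_cst; exists 1%N => // -[//|n] _.
rewrite /series /= big_nat_recl// big1 ?addr0 /exp_coeff/=.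
  by rewrite expr0 fact0 divr1 mul1r.
by move=> i _; rewrite expr0n /= !mul0r.
Qed.

Lemma is_derive_expRM (c C t : R) :
  is_derive t 1 (fun s => c * expR (C * s)) (c * (C * expR (C * t))).
Proof.
apply: is_deriveZ.
have H : is_derive t 1 (fun s : R => C * s) C.
  rewrite -[X in is_derive _ _ _ X]mulr1; apply: is_deriveZ; exact: is_derive_id.
rewrite mulrC; apply: (@is_derive1_comp _ expR); exact: is_derive_expR.
Qed.

(** The Carathéodory slope is continuous at [t] with value [d], hence positive nearby. The product
    form treats both sides of [t] at once. *)
Lemma is_derive_gt0_near {f t d} : is_derive t 1 f d -> 0 < d ->
  \forall s \near t, s != t -> 0 < (f s - f t) * (s - t).
Proof.
move=> /is_derive1_caratheodory[g [fg gt gtd]] d0.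
have : \forall s \near t, 0 < g s.
  by apply: (cvgr_gt _ gt 0); rewrite gtd.
apply: filterS => s gs st; rewrite fg -mulrA mulr_gt0//.
by rewrite -expr2 exprn_even_gt0//= subr_eq0.
Qed.

Lemma is_derive_cvg {f t d} : is_derive t 1 f d -> f s @[s --> t] --> f t.
Proof. by case=> /derivable1_diffP/differentiable_continuous. Qed.

Lemma is_derive_ge0_right f t d : is_derive t 1 f d -> f t = 0 ->
  (forall s, t <= s -> 0 <= f s) -> 0 <= d.
Proof.
move=> fd ft0 f0; rewrite leNgt; apply/negP => d0.
have Nfd : is_derive t 1 (- f) (- d) by exact: is_deriveN.
have /(is_derive_gt0_near Nfd)[e /= e0] : 0 < - d by rewrite oppr_gt0.
have ee : 0 < e / 2 by rewrite divr_gt0.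
move=> /(_ (t + e / 2)); rewrite /ball/= opprD addNKr normrN gtr0_norm//.
have -> : e / 2 < e by rewrite ltr_pdivrMr// ltr_pMr// ltr1n.
rewrite -subr_eq0 addrAC subrr add0r gt_eqF// => /(_ isT isT).
rewrite !fctE ft0 oppr0 subr0 pmulr_lgt0// oppr_gt0 ltNge f0//.
by rewrite lerDl ltW.
Qed.

Lemma finite_set_bound {T : choiceType} {A : set T} (F : T -> R) :
  finite_set A -> exists2 M, 0 <= M & forall x, A x -> F x <= M.
Proof.
move=> Afin; exists (\sum_(x \in A) `|F x|); first exact: fsumr_ge0.
move=> x Ax; rewrite (fsbigD1 x)//=.
by rewrite (le_trans (ler_norm _))// lerDl fsumr_ge0.
Qed.

Lemma finite_argmax {T : choiceType} (A : set T) (F : T -> R) (x0 : T) :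
  finite_set A -> A x0 -> exists2 x, A x & forall y, A y -> F y <= F x.
Proof.
move=> Afin Ax0.
suff H (s : seq T) : x0 \in s -> exists2 x, x \in s & forall y, y \in s -> F y <= F x.
  have [|x xA xmax] := H (finmap.enum_fset (fset_set A)).
    by rewrite in_fset_set// mem_set.
  move: xA; rewrite in_fset_set// inE => Ax; exists x => // y Ay.
  by apply: xmax; rewrite in_fset_set// mem_set.
case: s => [//|b s] _.
elim: s b => [b|c s IH b].
  by exists b => [|y]; rewrite inE// => /eqP->.
have [x xs xmax] := IH c.
have [bx|xb] := leP (F b) (F x).
  exists x => [|y]; first by rewrite inE xs orbT.
  by rewrite inE => /predU1P[->//|/xmax].
exists b => [|y]; first by rewrite mem_head.
by rewrite inE => /predU1P[->//|/xmax] /le_trans; apply; exact: ltW.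
Qed.

(* First-touching-time argument: at the infimum of the bad times some [D i]
   vanishes while all [D j] are nonnegative, so [D i] cannot be increasing. *)
Lemma barrier (I : choiceType) (A : set I) (D dD : I -> R -> R) :
  finite_set A ->
  (forall i t, A i -> is_derive t 1 (D i) (dD i t)) ->
  (forall i, A i -> 0 < D i 0) ->
  (forall i t, A i -> 0 < t -> D i t = 0 -> (forall j, A j -> 0 <= D j t) ->
    0 < dD i t) ->
  forall i t, A i -> 0 <= t -> 0 < D i t.
Proof.
move=> Afin Dder D0 Dtouch i t Ai t0; rewrite ltNge; apply/negP => Dit.
pose bad := [set s | 0 <= s /\ exists2 j, A j & D j s <= 0].
have badt : bad t by split => //; exists i.
have badlb : has_lbound bad by exists 0 => s [].
have badinf : has_inf bad by split; [exists t|].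
pose s := inf bad.
have s0 : 0 <= s by apply: lb_le_inf; [exists t|move=> x []].
have before u j : A j -> 0 <= u -> u < s -> 0 < D j u.
  move=> Aj u0 us; rewrite ltNge; apply/negP => Dju.
  have : s <= u by apply: ge_inf => //; split => //; exists j.
  by rewrite leNgt us.
(* Otherwise the finitely many [D j], positive at [s] and continuous there, stay positive on a
   common neighbourhood of [s], although bad times come arbitrarily close to their infimum. *)
have [j Aj Djs] : exists2 j, A j & D j s <= 0.
  apply: contrapT => nex.
  have Dpos j : A j -> 0 < D j s.
    by move=> Aj; rewrite ltNge; apply/negP => Djs; apply: nex; exists j.
  have [e /= e0 He] : \forall u \near s, forall j, A j -> 0 < D j u.
    have := @filter_bigI _ _ (fset_set A) (fun j => [set u | 0 < D j u]) (nbhs s).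
    rewrite fset_setK//; apply => j; rewrite in_fset_set// inE => Aj.
    exact: (cvgr_gt _ (is_derive_cvg (Dder j s Aj))) _ (Dpos _ Aj).
  have [u [u0 [j Aj Dju]] us] := inf_adherent e0 badinf.
  have su : s <= u by apply: ge_inf => //; split => //; exists j.
  have := He u; rewrite /ball/= distrC ger0_norm ?subr_ge0// ltrBlDl us.
  by move=> /(_ isT j Aj); rewrite ltNge Dju.
have s_gt0 : 0 < s.
  rewrite lt_neqAle s0 andbT; apply/eqP => s0'.
  by move: Djs; rewrite -s0' leNgt D0.
have Dge0 k : A k -> 0 <= D k s.
  move=> Ak; rewrite leNgt; apply/negP => Dks.
  have [e /= e0 He] := cvgr_lt _ (is_derive_cvg (Dder k s Ak)) _ Dks.
  (* A time in [[0, s)] closer to [s] than [e]: the bound [s / 2] keeps it nonnegative, the bound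
     [s - e / 2] keeps it close. *)
  pose u := Num.max (s / 2) (s - e / 2).
  have us : u < s.
    by rewrite /u gt_max; apply/andP; split; [lra|lra].
  have u0 : 0 <= u by rewrite /u le_max; apply/orP; left; lra.
  have := He u; rewrite /ball/= gtr0_norm ?subr_gt0//.
  have -> : s - u < e.
    have : s - e / 2 <= u by rewrite /u le_max lexx orbT.
    by move=> ?; lra.
  by move=> /(_ isT); rewrite ltNge ltW// before.
have Djs0 : D j s = 0 by apply/eqP; rewrite eq_le Djs Dge0.
have dpos := Dtouch j s Aj s_gt0 Djs0 Dge0.
have [e /= e0 He] := is_derive_gt0_near (Dder j s Aj) dpos.
pose u := Num.max (s / 2) (s - e / 2).
have us : u < s by rewrite /u gt_max; apply/andP; split; [lra|lra].
have u0 : 0 <= u by rewrite /u le_max; apply/orP; left; lra.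
have := He u; rewrite /ball/= gtr0_norm ?subr_gt0//.
have -> : s - u < e.
  have : s - e / 2 <= u by rewrite /u le_max lexx orbT.
  by move=> ?; lra.
rewrite lt_eqF// Djs0 subr0 => /(_ isT isT).
by rewrite nmulr_lgt0 ?subr_lt0// ltNge ltW// before.
Qed.

End real_analysis.

(** * The Laplacian as a finite sum, Dirichlet semigroups and the comparison principle *)

Section laplacian_theory.
Context {R : realType} (G : weighted_graph R).
Hypothesis Glf : locally_finite G.
Implicit Types (x y z : G) (f g u : G -> R) (W : set G) (t c : R).

Definition nbrs x : seq G := finmap.enum_fset (fset_set [set y | adj x y]).

Definition rate x y : R := (vmeasure x)^-1 * weight x y.

Lemma nbrsP x y : y \in nbrs x = adj x y.
Proof. by rewrite in_fset_set ?mem_setE//; exact: Glf. Qed.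

Lemma rate_ge0 x y : 0 <= rate x y.
Proof. by rewrite mulr_ge0 ?weight_ge0// invr_ge0 ltW ?vmeasure_gt0. Qed.

Lemma adj_sym x y : adj x y = adj y x.
Proof. by rewrite /adj weight_sym. Qed.

Lemma laplacianE f x : laplacian f x = \sum_(y <- nbrs x) rate x y * (f y - f x).
Proof.
rewrite /laplacian -(@fsbig_widen _ _ _ _ [set y | adj x y])//; last first.
  move=> y [_ /= /negP]; rewrite /adj -leNgt => w0.
  by rewrite (_ : weight x y = 0) ?mul0r//; apply/eqP; rewrite eq_le w0 weight_ge0.
rewrite fsbig_finite /=; last exact: Glf.
by rewrite mulr_sumr; apply: eq_bigr => y _; rewrite mulrA.
Qed.

(** Only the increments from [x] to its neighbours enter, with nonnegative coefficients. All
    maximum-principle arguments below go through this fact. *)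
Lemma le_laplacian f g x : (forall z, adj x z -> f z - f x <= g z - g x) ->
  laplacian f x <= laplacian g x.
Proof.
move=> fg; rewrite !laplacianE big_seq [leRHS]big_seq; apply: ler_sum => y.
by rewrite nbrsP => xy; rewrite ler_wpM2l ?rate_ge0 ?fg.
Qed.

Lemma eq_laplacian f g x : (forall z, adj x z -> f z - f x = g z - g x) ->
  laplacian f x = laplacian g x.
Proof.
by move=> fg; apply/eqP; rewrite eq_le !le_laplacian// => z xz; rewrite fg.
Qed.

Lemma laplacianD f g x : laplacian (f \+ g) x = laplacian f x + laplacian g x.
Proof.
rewrite !laplacianE -big_split /=; apply: eq_bigr => y _.
by rewrite -mulrDr; congr (_ * _); ring.
Qed.

Lemma laplacianZ c f x : laplacian (fun z => c * f z) x = c * laplacian f x.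
Proof.
rewrite !laplacianE mulr_sumr; apply: eq_bigr => y _.
by rewrite -mulrBr mulrCA.
Qed.

Lemma laplacianB f g x : laplacian (fun z => f z - g z) x = laplacian f x - laplacian g x.
Proof.
rewrite -mulN1r -laplacianZ -laplacianD; apply: eq_laplacian => z _ /=.
by rewrite !mulN1r.
Qed.

Lemma laplacian_norm_le f x c : (forall z, `|f z| <= c) ->
  `|laplacian f x| <= (\sum_(y <- nbrs x) rate x y) * (2 * c).
Proof.
move=> fc; rewrite laplacianE (le_trans (ler_norm_sum _ _ _))// mulr_suml.
apply: ler_sum => y _; rewrite normrM (ger0_norm (rate_ge0 _ _)).
apply: ler_wpM2l; first exact: rate_ge0.
rewrite (le_trans (ler_normB _ _))//.
by have := fc x; have := fc y; lra.
Qed.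

Section dirichlet.
Variables (W : set G) (Wfin : finite_set W).

Lemma indicE1 x : W x -> \1_W x = 1 :> R.
Proof. by move=> Wx; rewrite indicE mem_set. Qed.

Lemma indicE0 x : ~ W x -> \1_W x = 0 :> R.
Proof. by move=> Wx; rewrite indicE memNset. Qed.

Let iter_dirichlet f k := iter k (dirichlet_laplacian W) (\1_W \* f).

Let iter_dirichlet_out f k x : ~ W x -> iter_dirichlet f k x = 0.
Proof.
by case: k => [|k] Wx; rewrite /iter_dirichlet /= /dirichlet_laplacian /= indicE0// mul0r.
Qed.

Let iter_dirichletS f k x : W x ->
  iter_dirichlet f k.+1 x = laplacian (iter_dirichlet f k) x.
Proof.
move=> Wx; rewrite /iter_dirichlet /= /dirichlet_laplacian /= indicE1// mul1r.
congr laplacian; apply/funext => z /=; rewrite -/(iter_dirichlet f k).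
have [Wz|Wz] := pselect (W z); first by rewrite indicE1// mul1r.
by rewrite iter_dirichlet_out// mulr0.
Qed.

(** On the finite set [W] the weighted degree is bounded by some [C], so each application of the
    Laplacian multiplies a sup bound by at most [2 * C]. *)
Let exp_bounded_iter f x : exp_bounded (fun k => iter_dirichlet f k x).
Proof.
have [M M0 fM] := finite_set_bound (fun z => `|f z|) Wfin.
have [C C0 degC] := finite_set_bound (fun z => \sum_(y <- nbrs z) rate z y) Wfin.
exists M, (C * 2); split => //; first exact: mulr_ge0.
move=> k; elim: k x => [|k IH] x.
  rewrite expr0 mulr1 /iter_dirichlet /=.
  have [Wx|Wx] := pselect (W x); first by rewrite indicE1// mul1r fM.
  by rewrite indicE0// mul0r normr0.
have [Wx|Wx] := pselect (W x); last first.
  by rewrite iter_dirichlet_out// normr0 mulr_ge0// exprn_ge0// mulr_ge0.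
rewrite iter_dirichletS// (le_trans (laplacian_norm_le _ x _ IH))//.
rewrite exprS [leRHS](_ : _ = C * (2 * (M * (C * 2) ^+ k))); last by ring.
by apply: ler_wpM2r; [rewrite !mulr_ge0// exprn_ge0// mulr_ge0|exact: degC].
Qed.

Lemma dirichlet_semigroup_out f t x : ~ W x -> dirichlet_semigroup W t f x = 0.
Proof.
move=> Wx; rewrite /dirichlet_semigroup (_ : (fun _ => _) = cst 0).
  by apply/cvg_lim => //; apply: cvg_near_cst; apply: nearW => n; rewrite /series/= big1.
by apply/funext => k; rewrite -/(iter_dirichlet f k) iter_dirichlet_out// mulr0.
Qed.

Lemma dirichlet_semigroup0 f x : W x -> dirichlet_semigroup W 0 f x = f x.
Proof.
by move=> Wx; rewrite /dirichlet_semigroup -/(egs _ _) egs0/= indicE1// mul1r.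
Qed.

(** Inside [W] the shifted sequence is the Laplacian of the iterates, and this Laplacian, a finite
    sum over neighbours, commutes with the limit of the partial sums. *)
Lemma is_derive_dirichlet_semigroup f x t : W x ->
  is_derive t 1 (fun s => dirichlet_semigroup W s f x)
    (laplacian (dirichlet_semigroup W t f) x).
Proof.
move=> Wx.
rewrite (_ : laplacian _ _ = egs (fun k => iter_dirichlet f k.+1 x) t).
  exact: (is_derive_egs _ _ (exp_bounded_iter f x)).
apply/esym/cvg_lim => //.
rewrite (_ : series _ = fun n => \sum_(y <- nbrs x) rate x y *
  (series (fun k => exp_coeff t k * iter_dirichlet f k y) n -
   series (fun k => exp_coeff t k * iter_dirichlet f k x) n)); last first.
  apply/funext => n.
  transitivity (\sum_(0 <= k < n) exp_coeff t k * iter_dirichlet f k.+1 x) => //.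
  under eq_bigr => k _ do rewrite (iter_dirichletS f k x Wx) laplacianE mulr_sumr.
  rewrite exchange_big /series /=; apply: eq_bigr => y _.
  by rewrite -sumrB mulr_sumr; apply: eq_bigr => k _; ring.
rewrite laplacianE; apply: cvg_big; first exact: add_continuous.
by move=> y _; apply: cvgMr; apply: cvgB;
  exact/cvg_egs/exp_bounded_iter.
Qed.

End dirichlet.

(** Parabolic minimum principle. The perturbation [u + e' * expR t] cannot touch zero: at such a
    point [u] is minimal in space, so its Laplacian is nonnegative, and the perturbation contributes
    a strictly positive time derivative. *)
Lemma heat_comparison W (u du : R -> G -> R) : finite_set W ->
  (forall t x, W x -> is_derive t 1 (fun s => u s x) (du t x)) ->
  (forall t x, W x -> 0 <= t -> laplacian (u t) x <= du t x) ->
  (forall t x, ~ W x -> 0 <= t -> 0 <= u t x) ->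
  (forall x, W x -> 0 <= u 0 x) ->
  forall t x, 0 <= t -> 0 <= u t x.
Proof.
move=> Wfin uder usup uout u0 t x t0.
have [Wx|Wx] := pselect (W x); last exact: uout.
apply/ler_addgt0Pr => e e0.
(* Rescaled so that the perturbation equals [e] exactly at the time [t] of interest. *)
have [e' e'0 ->] : exists2 e', 0 < e' & e = e' * expR t.
  by exists (e / expR t); [rewrite divr_gt0// expR_gt0|rewrite divfK// gt_eqF// expR_gt0].
apply/ltW; move: x t Wx t0.
apply: (@barrier _ _ W (fun x s => u s x + e' * expR s)
  (fun x s => du s x + e' *: expR s)) => //.
- by move=> x s Wx; have ? := uder s x Wx; apply: is_deriveD; exact: is_deriveZ.
- by move=> x Wx; rewrite expR0 mulr1 ltr_wpDl ?u0.
- move=> x s Wx s0 ux0 uge; rewrite ltr_wpDl ?mulr_gt0 ?expR_gt0//.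
  rewrite (le_trans _ (usup _ _ Wx (ltW s0)))//.
  (* Zero is rewritten as the Laplacian of a constant function, which puts the goal in the form of
     [le_laplacian]. *)
  rewrite -[leLHS](mul0r (laplacian (cst 0) x)) -laplacianZ.
  apply: le_laplacian => z _; rewrite !mul0r subrr subr_ge0.
  have -> : u s x = - (e' * expR s) by lra.
  have [Wz|Wz] := pselect (W z); first by have := uge z Wz; lra.
  by rewrite (le_trans _ (uout _ _ Wz (ltW s0)))// oppr_le0 mulr_ge0 ?expR_ge0// ltW.
Qed.

Section dirichlet_order.
Context {W : set G} (Wfin : finite_set W).
Implicit Type M : R.

Lemma dirichlet_semigroup_ge0 f t x : (forall z, 0 <= f z) -> 0 <= t ->
  0 <= dirichlet_semigroup W t f x.
Proof.
move=> f0; move: t x; apply: (heat_comparison W _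
  (fun t => laplacian (dirichlet_semigroup W t f))) => //.
- by move=> t x Wx; exact: is_derive_dirichlet_semigroup.
- by move=> t x Wx _; rewrite dirichlet_semigroup_out.
- by move=> x Wx; rewrite dirichlet_semigroup0.
Qed.

Lemma dirichlet_semigroup_le f M t x : (forall z, f z <= M) -> 0 <= M -> 0 <= t ->
  dirichlet_semigroup W t f x <= M.
Proof.
move=> fM M0 t0; rewrite -subr_ge0; move: t x t0.
apply: (heat_comparison W _
  (fun t x => - laplacian (dirichlet_semigroup W t f) x)) => //.
- move=> t x Wx; rewrite -[X in is_derive _ _ _ X]sub0r.
  by apply: is_deriveB; exact: is_derive_dirichlet_semigroup.
- move=> t x Wx _; rewrite /= -mulN1r -laplacianZ; apply: le_laplacian => z _.
  by rewrite !mulN1r; lra.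
- by move=> t x Wx _; rewrite dirichlet_semigroup_out// subr0.
- by move=> x Wx; rewrite dirichlet_semigroup0// subr_ge0.
Qed.

End dirichlet_order.

Lemma dirichlet_semigroup_mono W W' f t x : finite_set W -> finite_set W' ->
  W `<=` W' -> (forall z, 0 <= f z) -> 0 <= t ->
  dirichlet_semigroup W t f x <= dirichlet_semigroup W' t f x.
Proof.
move=> Wfin W'fin WW' f0 t0; rewrite -subr_ge0; move: t x t0.
apply: (heat_comparison W _ (fun t x =>
  laplacian (dirichlet_semigroup W' t f) x - laplacian (dirichlet_semigroup W t f) x)) => //.
- move=> t x Wx; apply: is_deriveB; apply: is_derive_dirichlet_semigroup => //.
  exact: WW'.
- by move=> t x Wx _; rewrite laplacianB.
- move=> t x Wx t0; rewrite [X in _ - X]dirichlet_semigroup_out// subr0.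
  exact: dirichlet_semigroup_ge0.
- by move=> x Wx; rewrite !dirichlet_semigroup0 ?subrr//; exact: WW'.
Qed.

(** The right side solves the heat equation on [W] and equals [M] off [W], where it dominates the
    semigroup of [W']. The bound does not depend on [W'], so it survives the supremum defining the
    heat semigroup. *)
Lemma dirichlet_semigroup_upper W W' f (M : R) t x : finite_set W -> finite_set W' ->
  W `<=` W' -> (forall z, f z <= M) -> 0 <= M -> 0 <= t ->
  dirichlet_semigroup W' t f x <= M - dirichlet_semigroup W t (fun z => M - f z) x.
Proof.
move=> Wfin W'fin WW' fM M0 t0; rewrite -subr_ge0; move: t x t0.
apply: (heat_comparison W _ (fun t x =>
  - laplacian (dirichlet_semigroup W t (fun z => M - f z)) x
  - laplacian (dirichlet_semigroup W' t f) x)) => //.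
- move=> t x Wx; apply: is_deriveB; last first.
    by apply: is_derive_dirichlet_semigroup => //; exact: WW'.
  rewrite -[X in is_derive _ _ _ X]sub0r.
  by apply: is_deriveB; exact: is_derive_dirichlet_semigroup.
- move=> t x Wx _; rewrite -mulN1r -laplacianZ -laplacianB; apply: le_laplacian => z _.
  by rewrite !mulN1r; lra.
- move=> t x Wx t0; rewrite [X in _ - X - _]dirichlet_semigroup_out// subr0 subr_ge0.
  exact: dirichlet_semigroup_le.
- move=> x Wx; rewrite !dirichlet_semigroup0//; last exact: WW'.
  lra.
Qed.

End laplacian_theory.

(** * Balls of the path distance, the [r]-gradient and a scale-invariant curvature bound *)

Section distance.
Context {R : realType} {G : weighted_graph R}.
Hypothesis Glf : locally_finite G.
Implicit Types (x y z : G) (f g u : G -> R) (r m n : nat).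

Definition cball r x : set G := [set y | (dist x y <= r%:R%:E)%E].

Lemma dist_le_path x p : path (@adj R G) x p -> (dist x (last x p) <= (size p)%:R%:E)%E.
Proof. by move=> xp; apply: ereal_inf_lbound; exists p => //=; rewrite xp eqxx. Qed.

Lemma cballP r x y :
  cball r x y <-> exists p, [/\ path (@adj R G) x p, last x p = y & (size p <= r)%N].
Proof.
split; last first.
  move=> [p [xp <- pr]]; apply: (le_trans (dist_le_path x p xp)).
  by rewrite lee_fin ler_nat.
rewrite /cball /= => xyr.
(* Walk lengths are integers, so a walk of length below [r + 1] has length at most [r]; passing to
   [r.+1] gives the strict inequality that produces a walk. *)
have /ereal_inf_lt[_ [p /= /andP[xp /eqP lp] <-]] : (dist x y < r.+1%:R%:E)%E.
  by rewrite (le_lt_trans xyr)// lte_fin ltr_nat.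
by rewrite lte_fin ltr_nat ltnS => pr; exists p.
Qed.

Lemma cball_refl r x : cball r x x.
Proof. by apply/cballP; exists [::]. Qed.

Lemma cball_adj x y : adj x y -> cball 1 x y.
Proof. by move=> xy; apply/cballP; exists [:: y]; rewrite /= xy. Qed.

Lemma cball_trans m n x y z : cball m x y -> cball n y z -> cball (m + n) x z.
Proof.
move=> /cballP[p [xp xy pm]] /cballP[q [yq yz qn]]; apply/cballP; exists (p ++ q).
by rewrite cat_path xp xy yq last_cat xy yz size_cat leq_add.
Qed.

Lemma cball_sub m n x : (m <= n)%N -> cball m x `<=` cball n x.
Proof.
by move=> mn y /cballP[p [xp xy pm]]; apply/cballP; exists p; rewrite (leq_trans pm).
Qed.

Lemma cball_sym r x y : cball r x y -> cball r y x.
Proof.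
move=> /cballP[p [xp <- pr]]; apply/cballP; exists (rev (belast x p)).
have adjE : (fun a b : G => @adj R G b a) =2 @adj R G by move=> a b; exact: adj_sym.
by split; [rewrite rev_path (eq_path adjE)|case: (p) => //= *; rewrite rev_cons last_rcons|
  rewrite size_rev size_belast].
Qed.

Lemma cball_split m n x y : cball (m + n) x y -> exists2 z, cball m x z & cball n z y.
Proof.
move=> /cballP[p [xp xy pmn]]; exists (last x (take m p)).
  by apply/cballP; exists (take m p); rewrite take_path// size_take_min geq_minl.
apply/cballP; exists (drop m p); move: xp xy; rewrite -{1 2}(cat_take_drop m p).
by rewrite cat_path last_cat => /andP[_ ->] ->; rewrite size_drop leq_subLR.
Qed.

Lemma finite_cball r x : finite_set (cball r x).
Proof.
elim: r x => [|r IH] x.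
  apply: (sub_finite_set _ (finite_set1 x)) => y /cballP[p [_ yE]].
  by case: p yE => //= ->.
apply: (@sub_finite_set _ _ ([set x] `|` \bigcup_(z in [set z | adj x z]) cball r z)).
  move=> y /cballP[[|z p] [/= xp xy pr]]; first by left.
  by move: xp => /andP[xz zp]; right; exists z => //; apply/cballP; exists p.
rewrite finite_setU; split; first exact: finite_set1.
by apply: bigcup_finite => //; exact: Glf.
Qed.

Lemma dist_natP x y : dist x y = +oo%E \/ exists n, dist x y = n%:R%:E.
Proof.
have [[n xyn]|nex] := pselect (exists n, cball n x y); last first.
  left; apply/eqP; rewrite -leye_eq leNgt; apply/negP => /ereal_inf_lt[_ [p /= pP _] _].
  move/andP: pP => [xp /eqP lp]; apply: nex.
  by exists (size p); apply/cballP; exists p.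
right.
have ex : exists n, `[< cball n x y >] by exists n; apply/asboolP.
have [k /asboolP xyk kmin] := ex_minnP ex.
exists k; apply/eqP; rewrite eq_le xyk /=.
apply: le_ereal_inf_tmp => _ [p /= /andP[xp /eqP lp] <-].
by rewrite lee_fin ler_nat kmin//; apply/asboolP/cballP; exists p.
Qed.

(** The ball is finite and contains [x], so the supremum is attained; later facts on the gradient
    use this lemma instead of [sup]. *)
Lemma gradient_max r f x : exists2 y, cball r x y &
  gradient r f x = `|f y - f x| /\ forall z, cball r x z -> `|f z - f x| <= gradient r f x.
Proof.
have [y xy ymax] := finite_argmax (cball r x) (fun z => `|f z - f x|) x
  (finite_cball r x) (cball_refl r x).
suff -> : gradient r f x = `|f y - f x| by exists y.
apply/eqP; rewrite eq_le; apply/andP; split.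
  apply: ge_sup; first by exists `|f y - f x|, y.
  by move=> _ [z xz <-]; exact: ymax.
by apply: ub_le_sup; [exists `|f y - f x| => _ [z xz <-]; exact: ymax|exists y].
Qed.

Lemma le_gradient r f x y : cball r x y -> `|f y - f x| <= gradient r f x.
Proof. by have [z _ [_]] := gradient_max r f x; apply. Qed.

Lemma gradient_le r f x (c : R) : (forall y, cball r x y -> `|f y - f x| <= c) ->
  gradient r f x <= c.
Proof. by have [z xz [-> _]] := gradient_max r f x; apply. Qed.

Lemma gradient_ge0 r f x : 0 <= gradient r f x.
Proof. by have [z xz [-> _]] := gradient_max r f x. Qed.

Lemma eq_gradient r f g x : (forall y, cball r x y -> f y - f x = g y - g x) ->
  gradient r f x = gradient r g x.
Proof.
move=> fg; apply/eqP; rewrite eq_le; apply/andP; split; apply: gradient_le => y xy.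
  by rewrite fg// le_gradient.
by rewrite -fg// le_gradient.
Qed.

Lemma gradientZ r c f x : gradient r (fun z => c * f z) x = `|c| * gradient r f x.
Proof.
apply/eqP; rewrite eq_le; apply/andP; split.
  by apply: gradient_le => y xy; rewrite -mulrBr normrM ler_wpM2l// le_gradient.
have [y xy [-> _]] := gradient_max r f x.
by rewrite -normrM mulrBr; exact: (le_gradient r (fun z => c * f z)).
Qed.

Lemma gradient_le_bound r f x (M : R) : (forall z, 0 <= f z <= M) -> gradient r f x <= M.
Proof.
move=> fM; apply: gradient_le => y _.
by have /andP[? ?] := fM x; have /andP[? ?] := fM y; rewrite ler_norml; lra.
Qed.

(** The infimum ranges over functions of gradient 1 at [x]. Dividing [f] by its gradient there and
    using homogeneity of both operators removes the normalization. *)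
Lemma curvature_gradient (K : R) r f x y : (K%:E <= curvature r x y)%E ->
  0 < gradient r f x -> `|f y - f x| = gradient r f x ->
  (laplacian f y - laplacian f x) * Num.sg (f y - f x)
    <= laplacian (gradient r f) x - K * gradient r f x.
Proof.
move=> Kxy; set a := gradient r f x => a0 fa.
have ia0 : 0 < a^-1 by rewrite invr_gt0.
pose h z := a^-1 * f z.
have gradh : gradient r h = fun z => a^-1 * gradient r f z.
  by apply/funext => z; rewrite gradientZ gtr0_norm.
have hx : gradient r h x = 1 by rewrite gradh mulVf// gt_eqF.
have := le_trans Kxy (ereal_inf_lbound (S := [set _ | _ in _]) (x := _) _).
move=> /(_ _ (ex_intro2 _ _ h _ erefl)).
move=> H; have {H} := H (conj hx _).
have hyx : h y - h x = a^-1 * (f y - f x) by rewrite /h mulrBr.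
rewrite hx hyx normrM fa gtr0_norm// mulVf ?gt_eqF// => /(_ erefl).
rewrite lee_fin gradh !laplacianZ// sgrM (gtr0_sg ia0) mul1r -mulrBr -mulrA -mulrBr.
by rewrite ler_pdivlMl// mulrC; lra.
Qed.

End distance.

(** * The minimal heat semigroup between Dirichlet bounds, and its derivative at time 0 *)

Section heat.
Context {R : realType} {G : weighted_graph R}.
Hypothesis Glf : locally_finite G.
Implicit Types (x y z : G) (f g u : G -> R) (r m n : nat) (M t e : R) (W : set G).

Lemma heat_semigroupE t f x : 0 <= t -> (forall z, 0 <= f z) ->
  heat_semigroup t f x = sup [set dirichlet_semigroup W t f x | W in [set W | finite_set W]].
Proof.
move=> t0 f0; rewrite /heat_semigroup.
have -> : f^\+ = f by apply/funext => z; rewrite /funrpos; exact/max_idPl.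
have -> : f^\- = cst 0 by apply/funext => z; rewrite /funrneg; apply/max_idPr; rewrite oppr_le0.
suff -> : heat_semigroup_nneg t (cst 0) x = 0 by rewrite subr0.
rewrite /heat_semigroup_nneg [X in sup X](_ : _ = [set 0]) ?sup1//.
have H W : finite_set W -> dirichlet_semigroup W t (cst 0) x = 0.
  move=> Wfin; apply/eqP; rewrite eq_le.
  by rewrite (dirichlet_semigroup_le G Glf Wfin)// (dirichlet_semigroup_ge0 G Glf Wfin).
apply/seteqP; split => [_ [W Wfin <-]/=|_ ->]; first exact: H.
by exists set0; [exact: finite_set0|apply: H; exact: finite_set0].
Qed.

Section bounded.
Variables (f : G -> R) (M t : R).
Hypotheses (f0 : forall z, 0 <= f z) (fM : forall z, f z <= M) (t0 : 0 <= t).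

Let M0 x : 0 <= M. Proof. exact: le_trans (f0 x) (fM x). Qed.

Lemma heat_semigroup_le_bound (B : R) x :
  (forall W, finite_set W -> dirichlet_semigroup W t f x <= B) ->
  heat_semigroup t f x <= B.
Proof.
move=> H; rewrite heat_semigroupE//; apply: ge_sup => [|_ [W Wfin <-]]; last exact: H.
by exists (dirichlet_semigroup set0 t f x), set0 => //; exact: finite_set0.
Qed.

Lemma has_sup_dirichlet_semigroup x :
  has_sup [set dirichlet_semigroup W t f x | W in [set W | finite_set W]].
Proof.
split; first by exists (dirichlet_semigroup set0 t f x), set0 => //; exact: finite_set0.
by exists M => _ [W Wfin <-]; apply: (dirichlet_semigroup_le G Glf Wfin) => //; exact: M0 x.
Qed.

Lemma dirichlet_le_heat_semigroup W x : finite_set W ->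
  dirichlet_semigroup W t f x <= heat_semigroup t f x.
Proof.
move=> Wfin; rewrite heat_semigroupE//; apply: ub_le_sup; last by exists W.
by have [] := has_sup_dirichlet_semigroup x.
Qed.

(** Monotonicity in the finite set extends a good approximation to all larger finite sets, so
    several vertices can share one set. *)
Lemma heat_semigroup_adherent e x : 0 < e ->
  exists2 W, finite_set W & forall W', finite_set W' -> W `<=` W' ->
    heat_semigroup t f x - e < dirichlet_semigroup W' t f x.
Proof.
move=> e0; rewrite heat_semigroupE//.
have [_ [W /= Wfin <-] We] := sup_adherent e0 (has_sup_dirichlet_semigroup x).
exists W => // W' W'fin WW'; rewrite (lt_le_trans We)//.
exact: dirichlet_semigroup_mono.
Qed.

Lemma heat_semigroup_upper W x : finite_set W ->
  heat_semigroup t f x <= M - dirichlet_semigroup W t (fun z => M - f z) x.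
Proof.
move=> Wfin; apply: heat_semigroup_le_bound => W' W'fin.
(* [W'] need not contain [W], so the comparison is made on their union. *)
have WW'fin : finite_set (W `|` W') by rewrite finite_setU.
apply: (@le_trans _ _ (dirichlet_semigroup (W `|` W') t f x)).
  by apply: dirichlet_semigroup_mono => //; exact: subsetUr.
by apply: dirichlet_semigroup_upper => //; exact: M0 x.
Qed.

End bounded.

Lemma laplacian_dirichlet_semigroup0 W f x : cball 1 x `<=` W ->
  laplacian (dirichlet_semigroup W 0 f) x = laplacian f x.
Proof.
move=> xW; apply: (eq_laplacian _ Glf) => z xz; rewrite !dirichlet_semigroup0//.
  exact/xW/cball_refl.
exact/xW/cball_adj.
Qed.

(** The function [E] below replaces each heat semigroup by the Dirichlet bound that weakens the
    hypothesis. It is nonnegative for [t >= 0] and vanishes at 0, so its derivative there is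
    nonnegative. The pair [a], [b] will be an ordered version of the pair in the curvature, one for
    each sign. *)
Lemma heat_derivative0_le (K : R) (a b x : G) f g M :
  (forall z, 0 <= f z <= M) -> (forall z, 0 <= g z <= M) ->
  f a - f b = g x ->
  (forall t, 0 <= t -> heat_semigroup t f a - heat_semigroup t f b
     <= expR (- (K * t)) * heat_semigroup t g x) ->
  laplacian f a - laplacian f b <= laplacian g x - K * g x.
Proof.
move=> fM gM fab H.
have f0 z : 0 <= f z by case/andP: (fM z).
have fle z : f z <= M by case/andP: (fM z).
have g0 z : 0 <= g z by case/andP: (gM z).
have gle z : g z <= M by case/andP: (gM z).
(* The unit balls make the Dirichlet cut-off invisible to the Laplacian at [a], [b] and [x] at time
   0. *)
pose W := cball 1 a `|` cball 1 b `|` cball 1 x.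
have Wfin : finite_set W by rewrite !finite_setU; do !split; exact: finite_cball.
have aW : cball 1 a `<=` W by move=> z; left; left.
have bW : cball 1 b `<=` W by move=> z; left; right.
have xW : cball 1 x `<=` W by move=> z; right.
have [Wa Wb Wx] : [/\ W a, W b & W x].
  by split; [apply: aW|apply: bW|apply: xW]; exact: cball_refl.
pose S h z := fun t => dirichlet_semigroup W t h z.
have dS h z : cball 1 z `<=` W -> is_derive (0 : R) 1 (S h z) (laplacian h z).
  move=> zW; rewrite -(laplacian_dirichlet_semigroup0 W h z zW).
  by apply: is_derive_dirichlet_semigroup => //; exact/zW/cball_refl.
have SM h z : cball 1 z `<=` W ->
    is_derive (0 : R) 1 (fun t => M - S (fun z => M - h z) z t) (laplacian h z).
  move=> zW.
  have -> : laplacian h z = 0 - laplacian (fun z => M - h z) z.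
    rewrite sub0r -mulN1r -(laplacianZ _ Glf); apply: (eq_laplacian _ Glf) => y _.
    by rewrite !mulN1r; lra.
  by apply: is_deriveB; exact: dS.
pose E t := 1 * expR (- K * t) * (M - S (fun z => M - g z) x t)
  - (S f a t - (M - S (fun z => M - f z) b t)).
have S0 h z : W z -> S h z 0 = h z by move=> Wz; exact: dirichlet_semigroup0.
suff : 0 <= laplacian g x - K * g x - (laplacian f a - laplacian f b) by rewrite subr_ge0.
have dE : is_derive (0 : R) 1 E
    (laplacian g x - K * g x - (laplacian f a - laplacian f b)).
  have da := dS f a aW; have db := SM f b bW; have dg := SM g x xW.
  have de := is_derive_expRM 1 (- K) (0 : R).
  apply: (is_derive_eq (is_deriveB (is_deriveM de dg) (is_deriveB da db))).
  rewrite !S0// /GRing.scale /= mulr0 expR0; ring.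
apply: (is_derive_ge0_right _ _ _ dE).
- by rewrite /E mulr0 expR0 !S0//; lra.
- move=> t t0; rewrite /E subr_ge0 mul1r mulNr.
  apply: le_trans (le_trans (H t t0) _).
    rewrite lerB//; first exact: (@dirichlet_le_heat_semigroup f M).
    exact: heat_semigroup_upper.
  by rewrite ler_wpM2l ?expR_ge0//; exact: heat_semigroup_upper.
Qed.

Lemma curvature_of_gradient_estimate (K : R) r :
  (forall f : G -> R, (forall x, 0 < f x) -> bounded_fun f ->
   forall t, 0 <= t -> forall x : G,
     gradient r (heat_semigroup t f) x
       <= expR (- (K * t)) * heat_semigroup t (gradient r f) x) ->
  forall x y, cball r x y -> (K%:E <= curvature r x y)%E.
Proof.
move=> H x y xy; apply: le_ereal_inf_tmp => _ [f [fx fy] <-]; rewrite lee_fin.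
have [M M0 fM] := finite_set_bound (fun z => `|f z|) (finite_cball Glf r.+1 x).
(* Radius [r + 1] covers the neighbours of [y] and the [r]-balls around the neighbours of [x].
   Adding [M + 1] makes the values positive and leaves all increments inside this ball unchanged. *)
pose h z := if `[< cball r.+1 x z >] then f z + M + 1 else 1.
have hf z : cball r.+1 x z -> h z = f z + M + 1 by move=> xz; rewrite /h asboolT.
have h0 z : 0 < h z.
  rewrite /h; case: ifPn => // /asboolP/fM; rewrite ler_norml => /andP[? _].
  by lra.
have hM z : h z <= 2 * M + 1.
  rewrite /h; case: ifPn => [/asboolP/fM|_]; last by lra.
  by rewrite ler_norml => /andP[_ ?]; lra.
have hbnd : bounded_fun h.
  exists (2 * M + 1); split; first exact: num_real.
  by move=> N MN z _ /=; rewrite gtr0_norm// (le_trans (hM z))// ltW.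
have hh z : 0 <= h z <= 2 * M + 1 by rewrite ltW//= hM.
have gg z : 0 <= gradient r h z <= 2 * M + 1.
  by rewrite gradient_ge0//=; exact: gradient_le_bound.
have ball1 z w : cball 1 x z -> cball r z w -> cball r.+1 x w.
  by move=> xz zw; exact: (cball_trans 1 r _ z).
have bally z : cball r x z -> cball r.+1 x z by apply: cball_sub.
have ballx z : adj x z -> cball r.+1 x z.
  by move=> /cball_adj; apply: cball_sub.
have xx : cball r.+1 x x by exact: cball_refl.
have gradE z : cball 1 x z -> gradient r h z = gradient r f z.
  move=> xz; apply: eq_gradient => // w zw.
  rewrite !hf; [lra|apply: (ball1 z) => //; exact: cball_refl|exact: ball1 zw].
have gx : gradient r h x = 1 by rewrite gradE//; exact: cball_refl.
have lapg : laplacian (gradient r h) x = laplacian (gradient r f) x.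
  apply: (eq_laplacian _ Glf) => z xz; rewrite !gradE//; first exact: cball_refl.
  exact: cball_adj.
have lapx : laplacian h x = laplacian f x.
  apply: (eq_laplacian _ Glf) => z xz; rewrite !hf//; last exact: ballx.
  by lra.
have lapy : laplacian h y = laplacian f y.
  apply: (eq_laplacian _ Glf) => z yz; rewrite !hf//; first by lra.
    exact: bally.
  by rewrite -addn1; apply: (cball_trans r 1 _ y) => //; exact: cball_adj.
have hyx : h y - h x = f y - f x by rewrite !hf//; [lra|exact: bally].
rewrite -hyx -lapg -lapx -lapy.
(* The absolute value in the gradient estimate allows both orders of [x] and [y]; the order with
   increment 1 is selected by the sign. *)
have key a b : cball r x a -> cball r x b -> (a = x \/ b = x) -> h a - h b = 1 ->
    laplacian h a - laplacian h b <= laplacian (gradient r h) x - K.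
  move=> xa xb abx hab; have -> : K = K * gradient r h x by rewrite gx mulr1.
  apply: (@heat_derivative0_le _ _ _ _ _ _ (2 * M + 1)) => //; first by rewrite gx.
  move=> t t0; apply: le_trans (H h h0 hbnd t t0 x).
  apply: (le_trans (ler_norm _)).
  case: abx => ->; last exact: le_gradient.
  by rewrite distrC; exact: le_gradient.
have hyx1 : `|h y - h x| = 1 by rewrite hyx fy fx.
have [hpos|hneg] := leP 0 (h y - h x).
  have e : h y - h x = 1 by rewrite -hyx1 ger0_norm.
  rewrite e sgr1 mulr1.
  by have := key y x xy (cball_refl r x) (or_intror erefl) e; lra.
have e : h x - h y = 1 by rewrite -hyx1 ltr0_norm// opprB.
rewrite (ltr0_sg hneg) mulrN1.
by have := key x y (cball_refl r x) xy (or_introl erefl) e; lra.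
Qed.

End heat.

(** * From the curvature bound to a gradient estimate on finite sets *)

Section gradient_estimate.
Context {R : realType} {G : weighted_graph R}.
Hypothesis Glf : locally_finite G.
Variables (r : nat) (K : R).
Hypothesis r_gt0 : (0 < r)%N.
Hypothesis curvK : forall x y : G, cball r x y -> (K%:E <= curvature r x y)%E.
Implicit Types (x y z : G) (m n : nat) (t : R) (W : set G).

Section lyapunov.
Variable x0 : G.

(* The junk value [fine +oo = 0] makes [rho] vanish off the component of [x0]. *)
Definition rho x : R := fine (dist x0 x).

Lemma rho_ge0 x : 0 <= rho x.
Proof. by rewrite /rho; have [->|[n ->]] := dist_natP x0 x. Qed.

Lemma rhoxx : rho x0 = 0.
Proof.
have := cball_refl 0 x0; rewrite /cball /rho /=.
have [->//|[n ->]] := dist_natP x0 x0.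
by rewrite lee_fin => n0 /=; apply/eqP; rewrite eq_le n0 ler0n.
Qed.

Lemma rho_le m x : cball m x0 x -> rho x <= m%:R.
Proof.
rewrite /cball /rho /=; have [->|[n ->]] := dist_natP x0 x; last by rewrite lee_fin.
by rewrite leye_eq.
Qed.

Lemma rho_gt m x : ~ cball m x0 x -> cball m.+1 x0 x -> m.+1%:R <= rho x.
Proof.
rewrite /cball /rho /=; have [->|[n ->]] := dist_natP x0 x; first by rewrite leye_eq.
by rewrite !lee_fin /= !ler_nat => /negP; rewrite -ltnNge.
Qed.

Lemma cball_rho n x : cball n x0 x -> exists2 k, cball k x0 x & rho x = k%:R.
Proof.
rewrite /cball /rho /=; have [->|[k ->]] := dist_natP x0 x; first by rewrite leye_eq.
by move=> _; exists k.
Qed.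

(** If [y] lies off the component of [x0], then [rho y = 0] and the bound is trivial; otherwise [x]
    lies in that component too and the triangle inequality applies. *)
Lemma rho_lipschitz n x y : cball n x y -> rho y - rho x <= n%:R.
Proof.
move=> xy; rewrite {1}/rho; have [->|[k yk]] := dist_natP x0 y.
  by rewrite /= sub0r (@le_trans _ _ 0)// oppr_le0 rho_ge0.
rewrite yk /=.
have : cball (k + n) x0 x.
  by apply: (cball_trans _ _ _ y); [rewrite /cball /= yk|exact: cball_sym].
move=> /cball_rho[l x0x ->].
have : cball (l + n) x0 y by exact: cball_trans xy.
by rewrite /cball /= yk lee_fin lerBlDl natrD.
Qed.

Lemma gradient_rho_le x : gradient r rho x <= r%:R.
Proof.
apply: gradient_le => // y xy; rewrite ler_norml.
have := rho_lipschitz r x y xy; have := rho_lipschitz r y x (cball_sym _ _ _ xy).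
by move=> ? ?; apply/andP; split; lra.
Qed.

(* Applying the curvature bound to [rho] itself, with [y] lying [r] steps closer
   to [x0] along a geodesic, propagates an upper bound on the Laplacian of [rho]. *)
Lemma laplacian_rho_le : exists2 C, 0 <= C &
  forall n x, cball n x0 x -> laplacian rho x <= C * (1 + rho x).
Proof.
have [A A0 HA] := finite_set_bound (laplacian rho) (finite_cball Glf r x0).
suff H k x : cball k x0 x -> rho x = k%:R -> laplacian rho x <= A + `|K| * k%:R.
  exists (A + `|K|); first exact: addr_ge0.
  move=> n x /cball_rho[k xk rk]; rewrite (le_trans (H k x xk rk))//.
  rewrite rk mulrDr mulr1 mulrDl.
  by have := mulr_ge0 A0 (ler0n R k); have := normr_ge0 K; lra.
elim/ltn_ind: k x => k IH x xk rk.
have [kr|rk'] := leqP k r.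
  by rewrite (le_trans (HA x _)) ?lerDl ?mulr_ge0//; exact: cball_sub xk.
have krr : (k - r + r = k)%N by rewrite subnK// ltnW.
have [y x0y yx] : exists2 y, cball (k - r) x0 y & cball r y x.
  by apply: cball_split; rewrite krr.
have ry : rho y = (k - r)%:R.
  apply/eqP; rewrite eq_le rho_le//=.
  by have := rho_lipschitz r y x yx; rewrite rk lerBlDl natrB ?lerBlDr ?(ltnW rk').
have ryx : rho y - rho x = - r%:R by rewrite ry rk natrB ?(ltnW rk')//; lra.
have r0 : 0 < r%:R :> R by rewrite ltr0n.
have xy : cball r x y by exact: cball_sym.
have gx : gradient r rho x = r%:R.
  apply/eqP; rewrite eq_le gradient_rho_le/=.
  by have := le_gradient Glf r rho x y xy; rewrite ryx normrN gtr0_norm.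
have := curvature_gradient Glf K r rho x y (curvK _ _ xy).
rewrite gx ryx normrN gtr0_norm// sgrN gtr0_sg// => /(_ r0 erefl).
(* The gradient of [rho] reaches its global bound [r] at [x], so its Laplacian there is
   nonpositive. *)
have : laplacian (gradient r rho) x <= 0.
  rewrite -(mul0r (laplacian (cst 0) x)) -laplacianZ//.
  by apply: le_laplacian => // z _; rewrite gx !mul0r subrr subr_le0 gradient_rho_le.
(* The descent from [k] to [k - r] is strict because [r] is positive. *)
have := IH (k - r)%N _ y x0y ry; rewrite ltn_subLR ?(ltnW rk')// => /(_ _).
rewrite -[X in (X < _)%N]add0n ltn_add2r => /(_ r_gt0).
rewrite natrB ?(ltnW rk')// mulrBr.
have : K * r%:R >= - (`|K| * r%:R) by rewrite -mulNr ler_wpM2r// lerNnormlW.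
by lra.
Qed.

End lyapunov.

Section dirichlet_gradient.
Variables (x0 : G) (C : R) (f : G -> R) (M : R) (m : nat) (W : set G).
Hypotheses (C0 : 0 <= C)
  (lapC : forall n x, cball n x0 x -> laplacian (rho x0) x <= C * (1 + rho x0 x))
  (M0 : 0 < M) (f0M : forall z, 0 <= f z <= M)
  (Wfin : finite_set W) (Wball : cball (m + r.+1) x0 `<=` W).

Let u t := dirichlet_semigroup W t f.
Let v t := dirichlet_semigroup W t (gradient r f).
(** Chosen so that [eps * phi] is at least [M], the trivial bound on the gradient, at distance
    [m + 1] from [x0]. *)
Let eps : R := M / m.+1%:R.
(** This growth rate strictly beats both [C], from the Laplacian of [phi], and [- K], from the
    curvature term. *)
Let L : R := C + `|K| + 1.
Let phi x : R := 1 + rho x0 x.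
Let H t x := 1 * expR (- K * t) * v t x + eps * expR (L * t) * phi x.

Let u0M t x : 0 <= t -> 0 <= u t x <= M.
Proof.
move=> t0; apply/andP; split.
  by apply: dirichlet_semigroup_ge0 => // z; case/andP: (f0M z).
by apply: dirichlet_semigroup_le => // [z|]; [case/andP: (f0M z)|exact: ltW].
Qed.

Let v0 t x : 0 <= t -> 0 <= v t x.
Proof. by move=> t0; apply: dirichlet_semigroup_ge0 => // z; exact: gradient_ge0. Qed.

Let eps0 : 0 < eps. Proof. by rewrite divr_gt0// ltr0n. Qed.

Let phi0 x : 0 < phi x. Proof. by rewrite ltr_pwDl// rho_ge0. Qed.

Let H_gt0 t x : 0 <= t -> 0 < H t x.
Proof.
move=> t0; rewrite /H mul1r ltr_wpDl//; first by rewrite mulr_ge0 ?expR_ge0 ?v0.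
by rewrite !mulr_gt0 ?expR_gt0.
Qed.

Let dH t x : R := - K * (expR (- K * t) * v t x) + expR (- K * t) * laplacian (v t) x
  + L * (eps * expR (L * t) * phi x).

Let is_derive_H t x : W x -> is_derive t 1 (fun s => H s x) (dH t x).
Proof.
move=> Wx.
have dv := is_derive_dirichlet_semigroup G Glf W Wfin (gradient r f) x t Wx.
have d1 := is_derive_expRM 1 (- K) t; have d2 := is_derive_expRM eps L t.
apply: (is_derive_eq (is_deriveD (is_deriveM d1 dv)
  (is_deriveM d2 (is_derive_cst (phi x) t 1)))).
by rewrite /dH /GRing.scale /= -/(v t); ring.
Qed.

Lemma dirichlet_gradient_estimate t x y : 0 <= t -> cball m x0 x -> cball r x y ->
  `|u t y - u t x| <= expR (- (K * t)) * v t x + eps * expR (L * t) * phi x.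
Proof.
move=> t0 x0x xy.
have {1}-> : expR (- (K * t)) = 1 * expR (- K * t) by rewrite mul1r mulNr.
rewrite -/(H t x).
(* The boolean carries a sign, which splits the absolute value into two differentiable gaps [D]. *)
pose I := (G * G * bool)%type.
pose A : set I := [set p | cball m x0 p.1.1 /\ cball r p.1.1 p.1.2].
have AW (p : I) : A p -> W p.1.1 /\ W p.1.2.
  move=> [Ax Ay]; split; apply: Wball; first by apply: cball_sub Ax; exact: leq_addr.
  apply: (cball_sub (m + r)); first by rewrite leq_add2l.
  exact: cball_trans Ay.
have Afin : finite_set A.
  apply: (@sub_finite_set _ _ ((W `*` W) `*` [set: bool])).
    by move=> p /AW[].
  by apply: finite_setX => //; exact: finite_setX.
pose D (p : I) s := H s p.1.1 - (-1) ^+ p.2 * (u s p.1.2 - u s p.1.1).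
pose dD (p : I) s := dH s p.1.1 -
  (-1) ^+ p.2 * (laplacian (u s) p.1.2 - laplacian (u s) p.1.1).
have Dpos (p : I) s : A p -> 0 <= s -> 0 < D p s.
  move: p s; apply: (@barrier _ _ A D dD) => //.
  - move=> p s /AW[W1 W2].
    have d1 := is_derive_H s _ W1.
    have d2 := is_derive_dirichlet_semigroup G Glf W Wfin f _ s W1.
    have d3 := is_derive_dirichlet_semigroup G Glf W Wfin f _ s W2.
    exact: (is_deriveB d1 (is_deriveZ ((-1) ^+ p.2) (is_deriveB d3 d2))).
  - move=> p Ap; have [W1 W2] := AW p Ap.
    rewrite /D /H !mulr0 expR0 !mulr1 !mul1r /u /v !dirichlet_semigroup0// subr_gt0.
    apply: (@le_lt_trans _ _ (gradient r f p.1.1)); last by rewrite ltrDl mulr_gt0.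
    rewrite (le_trans (ler_norm _))// normrM normr_sign mul1r.
    by apply: le_gradient => //; case: Ap.
  - move=> [[a b] s'] s Ap s0 D0 Dge; rewrite /dD /=; rewrite /D /= in D0.
    have [/= x0a ab] := Ap.
    have s0' := ltW s0.
    (* Nonnegativity of all gaps bounds the gradient by [H] throughout the ball; at the touching
       pair it is an equality, attained at [b], as the curvature bound requires. *)
    have gradH z : cball m x0 z -> gradient r (u s) z <= H s z.
      move=> x0z; apply: gradient_le => // w zw; rewrite ler_norml.
      have := Dge ((z, w), true) (conj x0z zw); have := Dge ((z, w), false) (conj x0z zw).
      by rewrite /D /= expr0 expr1 => ? ?; apply/andP; split; lra.
    have Ha := H_gt0 s a s0'.
    have HE : H s a = (-1) ^+ s' * (u s b - u s a) by apply/eqP; rewrite -subr_eq0 D0.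
    have Hab : `|u s b - u s a| = H s a.
      by rewrite -[LHS]mul1r -(normr_sign R s') -normrM -HE gtr0_norm.
    have gradE : gradient r (u s) a = H s a.
      by apply/eqP; rewrite eq_le gradH//= -Hab; exact: le_gradient.
    have sgE : Num.sg (u s b - u s a) = (-1) ^+ s'.
      have : Num.sg ((-1) ^+ s' * (u s b - u s a)) = 1.
        by apply: gtr0_sg; rewrite -HE.
      rewrite sgrM sgrX sgrN1 => /(congr1 (fun c => (-1) ^+ s' * c)).
      by rewrite mulrA -signr_addb addbb mul1r mulr1.
    have := curvature_gradient Glf K r (u s) a b (curvK _ _ ab).
    rewrite gradE sgE Hab => /(_ Ha erefl).
    (* A neighbour [z] outside the ball is not controlled by the gaps. There [rho x0 z] is at least
       [m + 1], so the term with [eps] in [H] alone exceeds [M]. *)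
    have lapgrad : laplacian (gradient r (u s)) a <= laplacian (H s) a.
      apply: le_laplacian => // z az; rewrite gradE lerD2r.
      have [x0z|x0z] := pselect (cball m x0 z); first exact: gradH.
      have x0z' : cball m.+1 x0 z.
        by rewrite -addn1; apply: (cball_trans _ _ _ a) => //; exact: cball_adj.
      apply: (@le_trans _ _ M); first by apply: gradient_le_bound => // w; exact: u0M.
      have -> : M = eps * m.+1%:R by rewrite divfK// pnatr_eq0.
      rewrite /H mul1r; apply: ler_wpDl; first by rewrite mulr_ge0 ?expR_ge0 ?v0.
      rewrite -mulrA ler_pM2l// -[leLHS]mul1r ler_pM//.
        rewrite -expR0 ler_expR mulr_ge0 ?(ltW s0)// /L.
        by rewrite !addr_ge0.
      by rewrite /phi (le_trans (rho_gt x0 m z x0z x0z'))// lerDr.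
    have lapH : laplacian (H s) a <= expR (- K * s) * laplacian (v s) a
        + eps * expR (L * s) * (C * phi a).
      rewrite (_ : laplacian (H s) a = expR (- K * s) * laplacian (v s) a
        + eps * expR (L * s) * laplacian (rho x0) a).
        by rewrite lerD2l ler_wpM2l ?(lapC m)// mulr_ge0 ?expR_ge0// ltW.
      rewrite -!(laplacianZ _ Glf) -(laplacianD _ Glf); apply: (eq_laplacian _ Glf) => z _ /=.
      by rewrite /H /phi; ring.
    set e1 := expR (- K * s) in lapH *; set e2 := eps * expR (L * s) in lapH *.
    have e2phi : 0 < e2 * phi a by rewrite !mulr_gt0 ?expR_gt0.
    (* After inserting [lapgrad] and [lapH] in the curvature bound, the terms in [v] cancel and this
       quantity remains as a lower bound for the derivative of the gap. *)
    have KL : 0 < (L + K - C) * (e2 * phi a).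
      have KK : 0 <= `|K| + K by rewrite -lerBlDr sub0r -normrN ler_norm.
      by rewrite mulr_gt0// (_ : L + K - C = `|K| + K + 1) ?ltr_wpDl// /L; ring.
    rewrite /dH -/e1 -/e2 [H s a]/H -/e1 -/e2.
    move=> curv; 
    by lra.
rewrite ler_norml.
have := Dpos ((x, y), true) t (conj x0x xy) t0.
have := Dpos ((x, y), false) t (conj x0x xy) t0.
by rewrite /D /= expr0 expr1 => ? ?; apply/andP; split; lra.
Qed.

End dirichlet_gradient.

End gradient_estimate.

(** * Passage to the limit and the equivalence *)

Theorem theorem1p6 (R : realType) (G : weighted_graph R)
    (Glf : locally_finite G) (r : nat) (r_gt0 : (0 < r)%N) (K : R) :
  (forall x y : G, (dist x y <= r%:R%:E)%E -> (K%:E <= curvature r x y)%E)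
  <->
  (forall f : G -> R, (forall x, 0 < f x) -> bounded_fun f ->
   forall t : R, 0 <= t -> forall x : G,
     gradient r (heat_semigroup t f) x
       <= expR (- (K * t)) * heat_semigroup t (gradient r f) x).
Proof.
split; last by move=> H x y xy; exact: (curvature_of_gradient_estimate Glf).
move=> curvK f f_gt0 [N [_ fN]] t t0 x.
(* [bounded_fun] bounds [f] by every number strictly above [N]; the maximum with 1 ensures
   positivity. *)
pose M := Num.max 1 (N + 1).
have M0 : 0 < M by rewrite lt_max ltr01.
have fM z : f z <= M.
  rewrite (le_trans (ler_norm _))// (fN M)//.
  by rewrite lt_max ltrDl ltr01 orbT.
have f0 z : 0 <= f z by exact: ltW.
have f0M z : 0 <= f z <= M by rewrite f0 fM.
have g0 z : 0 <= gradient r f z by exact: gradient_ge0.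
have gM z : gradient r f z <= M by exact: gradient_le_bound.
apply: gradient_le => // y xy.
apply/ler_addgt0Pr => e e0.
have [C C0 lapC] := laplacian_rho_le Glf r K r_gt0 curvK x.
set L := C + `|K| + 1.
(* The constant [C], hence [L], is independent of [m], so [m] can be taken large enough to bring the
   error term at [x], where [rho] vanishes, below [e / 2]. *)
pose m := Num.truncn (2 * (M * expR (L * t)) / e).
have mP : M / m.+1%:R * expR (L * t) <= e / 2.
  rewrite mulrAC ler_pdivrMr ?ltr0n//.
  have : 2 * (M * expR (L * t)) / e < m.+1%:R by exact: truncnS_gt.
  by rewrite ltr_pdivrMr// => ?; lra.
have e2 : 0 < e / 2 by rewrite divr_gt0.
have [W1 W1fin HW1] := heat_semigroup_adherent Glf f M t f0 fM t0 (e / 2) x e2.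
have [W2 W2fin HW2] := heat_semigroup_adherent Glf f M t f0 fM t0 (e / 2) y e2.
(* [W1] and [W2] make the Dirichlet values at [x] and [y] accurate within [e / 2]. Both errors are
   one-sided, so the difference of the two values costs only [e / 2]. *)
pose W := W1 `|` W2 `|` cball (m + r.+1) x.
have Wfin : finite_set W by rewrite !finite_setU; do !split => //; exact: finite_cball.
have hx := HW1 W Wfin (fun z Wz => or_introl (or_introl Wz)).
have hy := HW2 W Wfin (fun z Wz => or_introl (or_intror Wz)).
have hx' := dirichlet_le_heat_semigroup Glf f M t f0 fM t0 W x Wfin.
have hy' := dirichlet_le_heat_semigroup Glf f M t f0 fM t0 W y Wfin.
have hg := dirichlet_le_heat_semigroup Glf (gradient r f) M t g0 gM t0 W x Wfin.
have := dirichlet_gradient_estimate Glf r K curvK x C f M m W C0 lapC M0 f0M Wfin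
  (fun z Wz => or_intror Wz) t x y t0 (cball_refl m x) xy.
rewrite rhoxx addr0 mulr1 ler_norml => /andP[l1 l2].
have := ler_wpM2l (expR_ge0 (- (K * t))) hg.
rewrite -/L in l1 l2 => hg'.
move: mP l1 l2 hx hy hx' hy' hg'.
move: (M / _ * _) (expR _ * heat_semigroup _ _ _) (expR _ * dirichlet_semigroup _ _ _ _).
by move=> *; rewrite ler_norml; apply/andP; split; lra.
Qed.
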